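(* Let $f=(f_1,f_2,\dots,f_m)$ where each $f_j\in C_0^\infty(\mathbb R^n)$, $1\le j\le m$, is real-valued, and let $p,q,n$ satisfy $0<q<2<p$ and $2<n<\frac{2(p-q)}{p-2}$. Then $$\int_{\mathbb R^n}|\nabla f(x)|^2\, dx\int_{\mathbb R^n}\frac{|f(x)|^{2p-2}}{|x|^{2q-2}}\,dx\;\geq\; \frac{(n-q)^2}{p^2}\left(\int_{\mathbb R^n}\frac{|f(x)|^p}{|x|^q}\,dx\right)^2 +\mathrm{COV}^2,$$ where $$\mathrm{COV} = \int_{\mathbb R^n}\frac{|f(x)|^{p}}{|x|^{q-1}}\,|\Phi_f'(x)|\,dx .$$
   Context: $C_0^\infty(\mathbb R^n)$ denotes the smooth functions with compact support in $\mathbb R^n$. For vector-valued $f=(f_1,\dots,f_m)$: $|f(x)|^2=\sum_{j=1}^m f_j(x)^2$ and $|\nabla f(x)|^2=\sum_{k=1}^n\sum_{j=1}^m|\partial_k f_j(x)|^2$. Generalized phase derivative: at points where $f(x)\ne 0$, $$|\Phi_f'(x)|=\left(\sum_{k=1}^n\sum_{1\leq j<l\leq m}\left(\frac{f_l(x)}{|f(x)|^2}\partial_k f_j(x)-\frac{f_j(x)}{|f(x)|^2}\partial_k f_l(x)\right)^2\right)^{1/2}.$$ Integrands containing the product of a positive power of $|f(x)|$ with $|\Phi_f'(x)|$ are taken to be $0$ at points where $f(x)=0$. *)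

(* Defs.v *)
From HB Require Import structures.
From mathcomp Require Import all_boot all_order all_algebra.
From mathcomp Require Import all_classical all_reals all_analysis.
Import Order.TTheory GRing.Theory Num.Theory.
Import numFieldTopology.Exports numFieldNormedType.Exports.

Set Implicit Arguments.
Unset Strict Implicit.
Unset Printing Implicit Defensive.

Local Open Scope classical_set_scope.
Local Open Scope ring_scope.

(* Row vectors carry the topology of the library and the product sigma-algebra,
   i.e. the one generated by the coordinate maps; for T = R it is the Borel
   sigma-algebra of R^n. *)
Section measurable_rV.
Context {d : measure_display} {T : measurableType d}.
Variable n : nat.

Definition rV_coord (i : 'I_n) (x : 'rV[T]_n) : T := x ord0 i.

Let rV_set0 : g_sigma_preimage rV_coord set0.
Proof. exact: sigma_algebra0. Qed.

Let rV_setC A : g_sigma_preimage rV_coord A -> g_sigma_preimage rV_coord (~` A).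
Proof. exact: sigma_algebraC. Qed.

Let rV_bigcup (F : (set 'rV[T]_n)^nat) :
  (forall i, g_sigma_preimage rV_coord (F i)) ->
  g_sigma_preimage rV_coord (\bigcup_i (F i)).
Proof. exact: sigma_algebra_bigcup. Qed.

HB.instance Definition _ := @isMeasurable.Build (measure_tuple_display d)
  'rV[T]_n (g_sigma_preimage rV_coord) rV_set0 rV_setC rV_bigcup.

End measurable_rV.

Lemma measurable_rV_coord d (T : measurableType d) n (i : 'I_n) :
  measurable_fun [set: 'rV[T]_n] (fun x => x ord0 i).
Proof.
move=> _ Y mY; rewrite setTI; apply: sub_sigma_algebra => /=.
rewrite -bigcup_seq/=; exists i => /=; first by rewrite mem_index_enum.
by exists Y => //; rewrite setTI.
Qed.

Lemma measurable_fun_rV d1 d2 (T1 : measurableType d1) (T2 : measurableType d2)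
    n (f : T1 -> 'rV[T2]_n) :
  (forall i, measurable_fun [set: T1] (fun x => f x ord0 i)) ->
  measurable_fun [set: T1] f.
Proof.
move=> mf _ A mA; rewrite setTI.
suff: g_sigma_preimage (@rV_coord _ T2 n) `<=` [set B | measurable (f @^-1` B)].
  by apply.
apply: smallest_sub => [|B].
  split => [|B /= mB|F mF] /=.
  - by rewrite preimage_set0.
  - by rewrite setTD; exact: measurableC mB.
  - by rewrite preimage_bigcup; apply: bigcup_measurable => k _; exact: mF.
rewrite -bigcup_seq => -[i _ [C mC <-]] /=.
by rewrite setTI -[X in measurable X]setTI; exact: mf.
Qed.

Section lebesgue_rV.
Context {R : realType}.

Definition rV_cons n (z : measurableTypeR R * 'rV[R]_n) : 'rV[R]_n.+1 :=
  row_mx (const_mx z.1 : 'rV[R]_1) z.2.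

Let rV_uncons n (x : 'rV[R]_n.+1) : measurableTypeR R * 'rV[R]_n :=
  (x ord0 ord0, \row_i x ord0 (lift ord0 i)).

Let rV_cons0 n z : @rV_cons n z ord0 ord0 = z.1.
Proof.
have -> : ord0 = lshift n ord0 :> 'I_(1 + n) by exact/val_inj.
by rewrite [LHS]row_mxEl mxE.
Qed.

Let rV_consS n z i : @rV_cons n z ord0 (lift ord0 i) = z.2 ord0 i.
Proof.
have -> : lift ord0 i = rshift 1 i :> 'I_(1 + n) by exact/val_inj.
exact: row_mxEr.
Qed.

Let rV_consK n : cancel (@rV_cons n) (@rV_uncons n).
Proof.
move=> [a x]; rewrite /rV_uncons rV_cons0; congr (_, _).
by apply/rowP => i; rewrite mxE rV_consS.
Qed.

Lemma measurable_rV_cons n : measurable_fun setT (@rV_cons n).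
Proof.
apply: measurable_fun_rV => i; case: (unliftP ord0 i) => [j ->|->].
  rewrite (_ : (fun _ => _) = (fun x : 'rV[R]_n => x ord0 j) \o snd).
    by apply: measurableT_comp => //; exact: measurable_rV_coord.
  by apply/funext => z; rewrite rV_consS.
rewrite (_ : (fun _ => _) = fst); first exact: measurable_fst.
by apply/funext => z; rewrite rV_cons0.
Qed.

Let measurable_rV_uncons n : measurable_fun setT (@rV_uncons n).
Proof.
apply/measurable_fun_pairP; split => /=.
  exact: measurable_rV_coord.
apply: measurable_fun_rV => i.
rewrite (_ : (fun _ => _) = (fun x : 'rV[R]_n.+1 => x ord0 (lift ord0 i))).
  exact: measurable_rV_coord.
by apply/funext => x; rewrite /= mxE.
Qed.

Section step.
Variables (n : nat) (mu : {sigma_finite_measure set 'rV[R]_n -> \bar R}).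

Definition lebesgue_rV_step : set 'rV[R]_n.+1 -> \bar R :=
  pushforward (@lebesgue_measure R \x mu)%E (@rV_cons n).

Let lebesgue_rV_step0 : lebesgue_rV_step set0 = 0%E.
Proof. by have mf := @measurable_rV_cons n; exact: measure0. Qed.

Let lebesgue_rV_step_ge0 A : (0 <= lebesgue_rV_step A)%E.
Proof. by have mf := @measurable_rV_cons n; exact: measure_ge0. Qed.

Let lebesgue_rV_step_sigma_additive : semi_sigma_additive lebesgue_rV_step.
Proof. by have mf := @measurable_rV_cons n; exact: measure_semi_sigma_additive. Qed.

HB.instance Definition _ := isMeasure.Build _ _ _ lebesgue_rV_step
  lebesgue_rV_step0 lebesgue_rV_step_ge0 lebesgue_rV_step_sigma_additive.

Let lebesgue_rV_step_sigma_finite : sigma_finite setT lebesgue_rV_step.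
Proof.
pose lebR : {sigma_finite_measure set (measurableTypeR R) -> \bar R} :=
  @lebesgue_measure R.
have /sigma_finiteP[F [TF ndF Foo]] := sigma_finiteT lebR.
have /sigma_finiteP[G [TG ndG Goo]] := sigma_finiteT mu.
exists (fun k => @rV_uncons n @^-1` (F k `*` G k)).
  apply/esym; rewrite -subTset => x _.
  have [i _ Fi] : (\bigcup_i F i) (x ord0 ord0) by rewrite -TF.
  have [j _ Gj] : (\bigcup_i G i) (rV_uncons x).2 by rewrite -TG.
  exists (maxn i j) => //; split => /=.
  - by move: Fi; exact/subsetPset/ndF/leq_maxl.
  - by move: Gj; exact/subsetPset/ndG/leq_maxr.
move=> k; have [mF Fk] := Foo k; have [mG Gk] := Goo k; split.
  rewrite -[X in measurable X]setTI; apply: measurable_rV_uncons => //.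
  exact: measurableX.
rewrite /lebesgue_rV_step /pushforward -comp_preimage.
rewrite (_ : _ \o _ = id) ?preimage_id; last first.
  by apply/funext => z /=; rewrite rV_consK.
by rewrite product_measure1E// lte_mul_pinfty// ge0_fin_numE.
Qed.

HB.instance Definition _ := Measure_isSigmaFinite.Build _ _ _ lebesgue_rV_step
  lebesgue_rV_step_sigma_finite.

End step.

(* Lebesgue measure on R^n, as the n-fold product of the Lebesgue measure on R;
   R^0 is a point, of measure 1. *)
Fixpoint lebesgue_rV n : {sigma_finite_measure set 'rV[R]_n -> \bar R} :=
  if n is m.+1 then lebesgue_rV_step (lebesgue_rV m) else \d_(0 : 'rV[R]_0).

Lemma lebesgue_rV_box n (A : 'I_n -> set R) : (forall i, measurable (A i)) ->
  lebesgue_rV n [set x | forall i, A i (x ord0 i)] =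
  (\prod_(i < n) @lebesgue_measure R (A i))%E.
Proof.
elim: n A => [|n IHn] A mA.
  rewrite big_ord0 /= diracE mem_set//=; by case.
rewrite big_ord_recl -IHn//= /lebesgue_rV_step /pushforward.
rewrite -product_measure1E//=.
  congr (_ _); apply/seteqP; split => z /=.
    move=> Az; split => [|i]; first by have := Az ord0; rewrite rV_cons0.
    by have := Az (lift ord0 i); rewrite rV_consS.
  move=> [Az0 Az] i; case: (unliftP ord0 i) => [j ->|->].
    by rewrite rV_consS; exact: Az.
  by rewrite rV_cons0.
  exact: mA.
rewrite [X in measurable X](_ : _ = \bigcap_(i in [set: 'I_n])
    ((fun x : 'rV[R]_n => x ord0 i) @^-1` A (lift ord0 i))).
  apply: fin_bigcap_measurable => // i _.
  by rewrite -[X in measurable X]setTI; exact: measurable_rV_coord.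
by apply/seteqP; split => x /= Ax i; [move=> _|]; exact: Ax.
Qed.

End lebesgue_rV.

Section test_functions.
Context {R : realType} {n : nat}.
Implicit Types g : 'rV[R]_n -> R.

Definition partial (k : 'I_n) g : 'rV[R]_n -> R := 'D_(delta_mx ord0 k) g.

Fixpoint is_Cr (r : nat) g : Prop :=
  if r is s.+1 then
    continuous g /\
    forall k : 'I_n,
      (forall x, derivable g x (delta_mx ord0 k)) /\ is_Cr s (partial k g)
  else continuous g.

Definition smooth g := forall r, is_Cr r g.

Definition C0infty g := smooth g /\ compact (closure [set x | g x != 0]).

End test_functions.

Section phase_derivative.
Context {R : realType}.

(* The library's norm on row vectors is the maximum norm. *)
Definition enorm {n} (x : 'rV[R]_n) : R := Num.sqrt (\sum_i x ord0 i ^+ 2).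

Context {n m : nat}.
Implicit Types (f : 'rV[R]_n -> 'rV[R]_m) (x : 'rV[R]_n).

Definition coord_fun f (j : 'I_m) : 'rV[R]_n -> R := fun x => f x ord0 j.

(* This is |grad f(x)|^2, not |grad f(x)|. *)
Definition grad_sq f x : R :=
  \sum_(k < n) \sum_(j < m) `|partial k (coord_fun f j) x| ^+ 2.

(* |Phi_f'(x)|; since division by 0 gives 0, it vanishes where f does, which is
   the convention wanted for its product with a positive power of |f(x)|. *)
Definition phase_deriv f x : R :=
  Num.sqrt (\sum_(k < n) \sum_(j < m) \sum_(l < m | (j < l)%N)
    (coord_fun f l x / enorm (f x) ^+ 2 * partial k (coord_fun f j) x -
     coord_fun f j x / enorm (f x) ^+ 2 * partial k (coord_fun f l) x) ^+ 2).

Definition COV (p q : R) f : \bar R :=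
  (\int[lebesgue_rV n]_x
     (enorm (f x) `^ p / enorm x `^ (q - 1) * phase_deriv f x)%:E)%E.

End phase_derivative.

(* Main.v *)
Require Import Defs.
From mathcomp Require Import all_boot all_order all_algebra.
From mathcomp Require Import all_classical all_reals all_analysis.
From mathcomp Require Import measurable_realfun ring lra.
Import Order.TTheory GRing.Theory Num.Theory.
Import numFieldTopology.Exports numFieldNormedType.Exports.
Local Open Scope classical_set_scope.
Local Open Scope ring_scope.

(** Write [u = |f|] and [g = u^(p-1) / |x|^(q-1)].  Where [f] is nonzero,
    Lagrange's identity applied to the vectors [f x] and [partial k f x], summed
    over [k], splits the gradient into a modulus part and a phase part:
      [|grad f|^2 = |grad u|^2 + (u |Phi_f'|)^2]
    (lemma [grad_sq_ge]).  Hence the product on the left of the theorem is at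
    least
      [(\int |grad u|^2) (\int g^2) + (\int (u |Phi_f'|)^2) (\int g^2)],
    and by Cauchy-Schwarz ([integral_cauchy_schwarz]) this dominates
      [(\int |grad u| g)^2 + (\int u |Phi_f'| g)^2].
    The second integral is exactly [COV].  What remains is the inequality
      [(n - q)/p \int u^p / |x|^q <= \int |grad u| g]
    (lemma [hardy_inequality]), an integration by parts: it expresses that the
    divergence of the field [u^p x / |x|^q] has integral zero, because
    [div (x / |x|^q) = (n - q) / |x|^q].

    The field is singular at the origin, so [|x|^2] is replaced by
    [e + |x|^2].  The regularized field is C^1 with bounded support, hence each
    of its diagonal partial derivatives integrates to zero
    ([integral_partial_eq0]).  The regularized divergence of the radial factor
    exceeds [(n - q) (e + |x|^2)^(-q/2)] by a nonnegative term, so the inequality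
    holds for every [e > 0] ([reg_hardy_inequality]), with a right-hand side that
    does not depend on [e]; Fatou's lemma then gives the limit.  Apart
    from that of the divergence, all integrals are those of nonnegative functions,
    valued in the extended reals, so that a divergent one does no harm. *)

(** * Continuity and measurability on row vectors *)

Section rV_topology.
Context {R : realType}.

Lemma rV_ballE n (x : 'rV[R]_n) (e : R) : 0 < e ->
  ball x e = \bigcap_(i in [set: 'I_n])
    ((fun y : 'rV[R]_n => y ord0 i) @^-1` ball (x ord0 i) e).
Proof.
move=> e0; apply/seteqP; split => y /=.
  by move=> [_ xy] i _; exact: xy.
by move=> xy; split => // i j; rewrite (ord1 i); exact: xy.
Qed.

Lemma measurable_ball_rV n (x : 'rV[R]_n) (e : R) : 0 < e ->
  measurable (ball x e).
Proof.
move=> e0; rewrite rV_ballE//; apply: fin_bigcap_measurable => // i _.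
rewrite -[X in measurable X]setTI; apply: measurable_rV_coord => //.
by rewrite ball_itv; exact: measurable_itv.
Qed.

(** The sigma-algebra is generated by the coordinates, so an open set has to be
    exhibited as a countable union of cubes; those with a rational center and a
    radius [1 / k.+1] suffice. *)
Lemma open_measurable_rV n (O : set 'rV[R]_n) : open O -> measurable O.
Proof.
move=> oO.
pose c (z : 'rV[rat]_n * nat) : 'rV[R]_n := map_mx ratr z.1.
pose B (z : 'rV[rat]_n * nat) := ball (c z) (z.2.+1%:R^-1 : R).
have -> : O = \bigcup_z (if `[< B z `<=` O >] then B z else set0).
  apply/seteqP; split => [x Ox|x [z _]]; last first.
    by case: ifPn => // /asboolP; exact.
  have [e /= e0 xO] : nbhs_ball x O by apply/nbhs_ballP; rewrite nbhsE; exists O.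
  (* Half of [e], as the cube must contain [x] and yet, seen from its own
     center, stay within [e] of [x]. *)
  have [k ke] : exists k : nat, (k.+1%:R : R)^-1 < e / 2.
    exists (Num.truncn (e / 2)^-1); rewrite invf_plt ?posrE ?divr_gt0//.
    exact: truncnS_gt.
  have k0 : (0 : R) < k.+1%:R^-1 by rewrite invr_gt0.
  have /choice[g gP] : forall i : 'I_n, exists r : rat,
      `|x ord0 i - ratr r| < k.+1%:R^-1.
    move=> i.
    have : x ord0 i - k.+1%:R^-1 < x ord0 i + k.+1%:R^-1.
      by rewrite ltrD2l gtrN.
    move=> /rat_in_itvoo[r]; rewrite inE /= => /itvP h; exists r.
    rewrite distrC ltr_distl; apply/andP; split; first by rewrite h.
    by rewrite h.
  have Bx : ball x k.+1%:R^-1 (c (\row_i g i, k)).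
    rewrite rV_ballE// => i _ /=; rewrite /ball/= /c !mxE/=; exact: gP.
  have BO : B (\row_i g i, k) `<=` O.
    move=> y By; apply: xO; apply: (le_ball (ltW _)); last first.
      exact: (ball_triangle Bx By).
    by rewrite (splitr e) ltrD.
  exists (\row_i g i, k) => //; rewrite asboolT//.
  exact: ball_sym.
apply: countable_bigcupT_measurable; first exact: countableP.
move=> z; case: ifPn => // _; exact: measurable_ball_rV.
Qed.

Lemma continuous_measurable_rV n (g : 'rV[R]_n -> R) :
  continuous g -> measurable_fun setT g.
Proof.
move=> /continuousP cg; apply: (measurability _ (RGenOpens.measurableE R)).
move=> _ [_ [a [b ->] <-]].
by rewrite setTI; apply: open_measurable_rV; exact/cg/interval_open.
Qed.

Lemma cvg_rV (T : Type) (F : set_system T) (FF : Filter F) n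
    (g : T -> 'rV[R]_n) (l : 'rV[R]_n) :
  (forall i, (fun t => g t ord0 i) @ F --> l ord0 i) -> g @ F --> l.
Proof.
move=> gl; apply/cvg_ballP => e e0.
have : \forall t \near F, forall i, ball (l ord0 i) e (g t ord0 i).
  by apply: filter_forall => i; move/cvg_ballP: (gl i); exact.
apply: filterS => t lt; rewrite rV_ballE// => i _; exact: lt.
Qed.

End rV_topology.

(** * The integral of a partial derivative with bounded support *)

Section integral_partial.
Context {R : realType}.

Definition supp_in_box {n} (M : R) (h : 'rV[R]_n -> R) :=
  forall (x : 'rV[R]_n) (i : 'I_n), M < `|x ord0 i| -> h x = 0.

Lemma lebesgue_rV_cube_lty n (M : R) :
  (lebesgue_rV n
    [set x : 'rV[R]_n | forall i, x ord0 i \in `[(- M)%R, M]%R]%classic < +oo)%E.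
Proof.
rewrite (lebesgue_rV_box (A := fun=> `[- M, M]%classic)); last first.
  by move=> i; exact: measurable_itv.
rewrite (_ : \prod_(i < n) _ =
  (\prod_(i < n) fine (lebesgue_measure `[(- M)%R, M%R]%classic))%:E)%E ?ltry//.
rewrite -prodEFin; apply: eq_bigr => i _; rewrite fineK//.
by rewrite /= lebesgue_measure_itv; case: ifPn.
Qed.

Lemma continuous_supp_in_box_integrable n (M : R) (g : 'rV[R]_n -> R) :
  continuous g -> supp_in_box M g ->
  (lebesgue_rV n).-integrable setT (EFin \o g).
Proof.
move=> cg gM.
pose A := [set x : 'rV[R]_n | forall i, x ord0 i \in `[- M, M]].
have mA : measurable A.
  rewrite (_ : A = \bigcap_(i in [set: 'I_n])
      ((fun x : 'rV[R]_n => x ord0 i) @^-1` `[- M, M])).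
    apply: fin_bigcap_measurable => // i _.
    by rewrite -[X in measurable X]setTI; exact: measurable_rV_coord.
  by apply/seteqP; split => x /= Ax i; [move=> _|]; exact: Ax.
have cA : compact A.
  apply: (@rV_compact _ _ (fun=> `[- M, M]%classic)) => i.
  exact: segment_compact.
have -> : EFin \o g = (EFin \o g) \_ A.
  apply/funext => x; rewrite patchE; case: ifPn => //.
  rewrite notin_setE /A /= => /existsNP[i] /negP.
  by rewrite in_itv/= -ler_norml -ltNge => /gM ->.
apply/integrable_restrict => //; rewrite setTI.
apply: measurable_bounded_integrable => //.
- exact: lebesgue_rV_cube_lty.
- by apply: measurable_funTS; exact: continuous_measurable_rV.
- have /compact_bounded := continuous_compact (continuous_subspaceT cg) cA.
  move=> [N [Nr gN]]; exists N; split => // x Nx y Ay.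
  by apply: (gN x Nx); exists y.
Qed.

(** The complement of the cube is open, so [h] vanishes near any point outside. *)
Lemma supp_in_box_partial n (M : R) (h : 'rV[R]_n -> R) k :
  supp_in_box M h -> supp_in_box M (partial k h).
Proof.
move=> hM x i xi; rewrite /partial.
rewrite (_ : 'D_(delta_mx ord0 k) h x = 'D_(delta_mx ord0 k) (cst 0) x).
  exact: derive_cst.
apply: near_eq_derive.
have : nbhs x [set y : 'rV[R]_n | M < `|y ord0 i|].
  have /cvgr_gt : (fun y : 'rV[R]_n => `|y ord0 i|) @ x --> `|x ord0 i|.
    apply: (@continuous_comp _ _ _ (fun y : 'rV[R]_n => y ord0 i) Num.norm).
      exact: coord_continuous.
    exact: norm_continuous.
  exact.
by apply: filterS => y /hM.
Qed.

(** The fundamental theorem of calculus on an interval at both ends of which [F]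
    vanishes. *)
Lemma integral_derive_eq0 (F G : R -> R) (M : R) :
  (forall t : R, is_derive t (1 : R) F (G t)) -> continuous G ->
  (forall t, M < `|t| -> F t = 0) ->
  (\int[lebesgue_measure]_t (G t)%:E = 0)%E.
Proof.
move=> dF cG FM.
(* Strictly beyond [M] so that [F] vanishes at both endpoints, and positive so
   that the interval is nondegenerate even for negative [M]. *)
pose N := `|M| + 1.
have N0 : 0 < N by rewrite ltr_wpDl.
have MN : M < N by rewrite (le_lt_trans (ler_norm M))// ltrDl.
have G0 t : M < `|t| -> G t = 0.
  move=> Mt; have [_ <-] := dF t.
  rewrite (_ : 'D_1 F t = 'D_1 (cst 0) t); first exact: derive_cst.
  apply: near_eq_derive.
  have : \forall y \near t, M < `|y|.
    have /cvgr_gt : (fun y : R => `|y|) @ t --> `|t| by exact: norm_continuous.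
    exact.
  by apply: filterS => y /FM.
have -> : (\int[lebesgue_measure]_t (G t)%:E =
    \int[lebesgue_measure]_(t in `[(- N)%R, N]) (G t)%:E)%E.
  rewrite [RHS]integral_mkcond; apply: eq_integral => t _.
  rewrite patchE; case: ifPn => //; rewrite notin_setE/= in_itv/=.
  move=> /negP; rewrite -ler_norml -ltNge => Nt.
  by rewrite G0// (lt_trans MN).
have cF : continuous F.
  move=> t; apply/differentiable_continuous/derivable1_diffP.
  by have [] := dF t.
rewrite (@continuous_FTC2 _ G F).
- rewrite !FM ?subee// ?normrN ?gtr0_norm//.
- by rewrite gtrN.
- exact: continuous_subspaceT.
- split => [t _||]; first by have [] := dF t.
  + exact/cvg_at_right_filter/cF.
  + exact/cvg_at_left_filter/cF.
- by move=> t _; rewrite derive1E; have [] := dF t.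
Qed.

Lemma rV_cons_ord0 n (z : measurableTypeR R * 'rV[R]_n) :
  rV_cons z ord0 ord0 = z.1.
Proof.
have -> : ord0 = lshift n ord0 :> 'I_(1 + n) by exact/val_inj.
by rewrite [LHS]row_mxEl mxE.
Qed.

Lemma rV_cons_lift n (z : measurableTypeR R * 'rV[R]_n) i :
  rV_cons z ord0 (lift ord0 i) = z.2 ord0 i.
Proof.
have -> : lift ord0 i = rshift 1 i :> 'I_(1 + n) by exact/val_inj.
exact: row_mxEr.
Qed.

Lemma rV_cons_shift_lift n (t s : R) (y : 'rV[R]_n) (j : 'I_n) :
  s *: delta_mx ord0 (lift ord0 j) + rV_cons (t, y) =
  rV_cons (t, s *: delta_mx ord0 j + y).
Proof.
apply/rowP => i; rewrite mxE; case: (unliftP ord0 i) => [l ->|->].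
  by rewrite !rV_cons_lift !mxE (inj_eq lift_inj).
by rewrite !rV_cons_ord0 !mxE /= mulr0 add0r.
Qed.

Lemma rV_cons_shift_ord0 n (t s : R) (y : 'rV[R]_n) :
  s *: delta_mx ord0 ord0 + rV_cons (t, y) = rV_cons (s *: (1 : R) + t, y).
Proof.
apply/rowP => i; rewrite mxE; case: (unliftP ord0 i) => [l ->|->].
  by rewrite !rV_cons_lift !mxE /= mulr0 add0r.
by rewrite !rV_cons_ord0 !mxE /=.
Qed.

Lemma continuous_rV_cons2 n (t : R) :
  continuous (fun y : 'rV[R]_n => rV_cons (t, y)).
Proof.
move=> y; apply: (cvg_rV _ _ (nbhs_filter y)) => i.
case: (unliftP ord0 i) => [l ->|->].
  under eq_fun do rewrite rV_cons_lift; rewrite rV_cons_lift.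
  exact: coord_continuous.
under eq_fun do rewrite rV_cons_ord0; rewrite rV_cons_ord0; exact: cvg_cst.
Qed.

Lemma continuous_rV_cons1 n (y : 'rV[R]_n) :
  continuous (fun t : R => rV_cons (t, y)).
Proof.
move=> t; apply: (cvg_rV _ _ (nbhs_filter t)) => i.
case: (unliftP ord0 i) => [l ->|->].
  under eq_fun do rewrite rV_cons_lift; rewrite rV_cons_lift; exact: cvg_cst.
under eq_fun do rewrite rV_cons_ord0; rewrite rV_cons_ord0; exact: cvg_id.
Qed.

(** A directional derivative only depends on the function along a line, whence
    the transfer of derivatives between spaces of different dimensions. *)
Lemma is_derive_eq_line (V W : normedModType R) (h : V -> R) (g : W -> R)
    x v y w :
  (forall s : R, h (s *: v + x) = g (s *: w + y)) ->
  derivable h x v -> is_derive y w g ('D_v h x).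
Proof.
move=> hg.
have E : (fun s : R => s^-1 *: (h (s *: v + x) - h x)) =
         (fun s : R => s^-1 *: (g (s *: w + y) - g y)).
  apply/funext => s; rewrite hg; congr (_ *: (_ - _)).
  by have := hg 0; rewrite !scale0r !add0r.
move=> dh; split; first by rewrite /derivable -E.
by rewrite /derive -E.
Qed.

(** Induction on the dimension, the measure on [R^(n+1)] being the image of a
    product.  For the first coordinate, Fubini's theorem lets it be integrated
    first, and each line contributes zero; for another one, the remaining
    coordinates are integrated first, and each slice contributes zero by the
    induction hypothesis. *)
Lemma integral_partial_eq0 n (k : 'I_n) (h : 'rV[R]_n -> R) (M : R) :
  (forall x, derivable h x (delta_mx ord0 k)) -> continuous (partial k h) ->
  supp_in_box M h -> (\int[lebesgue_rV n]_x (partial k h x)%:E = 0)%E.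
Proof.
elim: n k h M => [[]//|n IHn] k h M dh ch hM.
have mc := @measurable_rV_cons R n.
have ip : (lebesgue_rV n.+1).-integrable setT (EFin \o partial k h).
  apply: (continuous_supp_in_box_integrable _ M _ ch).
  exact: (supp_in_box_partial _ _ _ _ hM).
have mp : measurable_fun setT (EFin \o partial k h) by apply: measurable_int ip.
have ip' : (@lebesgue_measure R \x lebesgue_rV n)%E.-integrable setT
    ((EFin \o partial k h) \o @rV_cons R n).
  apply/integrableP; split; first exact: measurableT_comp.
  move/integrableP : ip => [_]; apply: le_lt_trans.
  rewrite [leRHS](ge0_integral_pushforward mc)//.
  exact: measurableT_comp.
transitivity (\int[(@lebesgue_measure R \x lebesgue_rV n)%E]_z
    ((EFin \o partial k h) \o @rV_cons R n) z)%E.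
  exact: (integral_pushforward mc).
case: (unliftP ord0 k) ip' dh ch {ip mp} => [j ->|->] ip' dh ch.
  rewrite -integral12_prod_meas1//; apply: integral0_eq => t _.
  have E y := @is_derive_eq_line _ _ h (fun y => h (rV_cons (t, y))) _ _ y _
    (fun s => congr1 h (rV_cons_shift_lift n t s y j)) (dh (rV_cons (t, y))).
  rewrite /fubini_F /=.
  have pE y : partial (lift ord0 j) h (rV_cons (t, y)) =
      partial j (fun y => h (rV_cons (t, y))) y.
    by rewrite /partial; have [_ ->] := E y.
  under eq_integral do rewrite pE.
  apply: (IHn _ _ M).
  - by move=> y; have [] := E y.
  - rewrite (_ : partial _ _ = partial (lift ord0 j) h \o
        (fun y => rV_cons (t, y))); last by apply/funext => y; rewrite /= pE.
    by move=> y; apply: continuous_comp;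
      [exact: continuous_rV_cons2|exact: ch].
  - by move=> y i yi; apply: (hM _ (lift ord0 i)); rewrite rV_cons_lift.
rewrite -integral21_prod_meas1//; apply: integral0_eq => y _.
rewrite /fubini_G /=.
apply: (@integral_derive_eq0 (fun t => h (rV_cons (t, y)))
  (fun t => partial ord0 h (rV_cons (t, y))) M).
- move=> t; apply: is_derive_eq_line => // s.
  by rewrite rV_cons_shift_ord0.
- by move=> t; apply: continuous_comp; [exact: continuous_rV_cons1|exact: ch].
- by move=> t Mt; apply: (hM _ ord0); rewrite rV_cons_ord0.
Qed.

End integral_partial.

(** * Powers of nonnegative functions *)

Section power_calculus.
Context {R : realType}.

(** A chain rule for directional derivatives that asks for no differentiability
    of [s] beyond the direction [v]: restrict to the line through [x]. *)
Lemma is_derive_comp1 (V : normedModType R) (phi : R -> R) (s : V -> R)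
    (x v : V) (a d : R) :
  is_derive (s x) (1 : R) phi a -> is_derive x v s d ->
  is_derive x v (phi \o s) (a * d).
Proof.
move=> dphi [ds <-].
pose s1 (t : R) := s (t *: v + x).
have s10 : s1 0 = s x by rewrite /s1 scale0r add0r.
have ds1 : is_derive (0 : R) (1 : R) s1 ('D_v s x).
  apply: is_derive_eq_line ds => t.
  by rewrite /s1 addr0 [t *: 1]mulr1.
rewrite -s10 in dphi.
have [dc <-] := is_derive1_comp dphi ds1.
apply: is_derive_eq_line dc => t.
by rewrite /s1 /= addr0 [t *: 1]mulr1.
Qed.

Lemma continuous_normr_powR (a : R) : 0 < a ->
  continuous (fun t : R => `|t| `^ a).
Proof.
move=> a0 x; have [->|x0] := eqVneq x 0.
  rewrite /continuous_at normr0 powR0 ?gt_eqF//.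
  apply/cvgr0Pnorm_lt => e e0.
  have ea0 : 0 < e `^ a^-1 by rewrite powR_gt0.
  have : nbhs (0 : R) [set t : R | `|t| < e `^ a^-1].
    apply/nbhs_ballP; exists (e `^ a^-1) => //= y.
    by rewrite /ball/= sub0r normrN.
  apply: filterS => t /= te; rewrite ger0_norm ?powR_ge0//.
  have a_neq0 : a != 0 by rewrite gt_eqF.
  rewrite -[ltRHS]powRr1 ?ltW// -(mulVf a_neq0) powRrM.
  by apply: gt0_ltr_powR => //; rewrite nnegrE ?powR_ge0.
apply: (@continuous_comp R R R (fun t : R => `|t|) (fun u : R => u `^ a)).
  exact: (@norm_continuous R R).
apply/differentiable_continuous/derivable1_diffP.
by apply: derivable_powR; rewrite in_itv/= andbT normr_gt0.
Qed.

(** The absolute value makes the power differentiable across [0]: since [1 < r],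
    the difference quotient there is bounded by [|h|^(r-1)]. *)
Lemma is_derive_normr_powR (r t : R) : 1 < r -> 0 <= t ->
  is_derive t (1 : R) (fun u : R => `|u| `^ r) (r * t `^ (r - 1)).
Proof.
move=> r1; rewrite le_eqVlt => /predU1P[<-|t0]; last first.
  have := @is_derive1_powR R r t t0; apply: near_eq_is_derive.
  by near=> u; rewrite gtr0_norm//; near: u; exact: lt_nbhsr.
rewrite powR0 ?mulr0; last by rewrite subr_eq0 gt_eqF.
have r0 : 0 < r by rewrite (lt_trans ltr01).
suff C : (fun h : R => h^-1 *: (`|h *: (1 : R) + 0| `^ r - `|0 : R| `^ r))
    @ (0 : R)^' --> (0 : R).
  apply: DeriveDef; first by apply/cvg_ex; exists 0.
  exact: cvg_lim.
have C : (fun h : R => `|h| `^ (r - 1)) @ (0 : R)^' --> (0 : R).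
  have := @continuous_normr_powR (r - 1); rewrite subr_gt0 => /(_ r1 0).
  rewrite /continuous_at normr0 powR0; last by rewrite subr_eq0 gt_eqF.
  move=> c; apply: cvg_trans c; apply: cvg_app.
  exact: nbhs_dnbhs.
apply/cvgr0Pnorm_lt => e e0; move/cvgr0Pnorm_lt : C => /(_ e e0).
apply: filter_app; near=> h.
have h0 : h != 0 by near: h; exact: nbhs_dnbhs_neq.
apply: le_lt_trans.
rewrite addr0 normr0 powR0 ?gt_eqF// subr0 [h *: 1]mulr1.
rewrite [_ *: _]/(_ * _) !normrM normfV.
rewrite !(ger0_norm (powR_ge0 _ _)) powRB ?powRr1 ?normr_ge0//.
  by rewrite mulrC.
by rewrite normr_eq0 h0 implybT.
Unshelve. all: by end_near. Qed.

(** As [1 < r], the power is differentiable at the zeros of [s] too; this is why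
    [|f|^p = (|f|^2)^(p/2)] is C^1 although [|f|] need not be. *)
Lemma is_derive_powR_ge0 (V : normedModType R) (s : V -> R) (x v : V)
    (d r : R) :
  1 < r -> (forall y, 0 <= s y) -> is_derive x v s d ->
  is_derive x v (fun y => s y `^ r) (r * s x `^ (r - 1) * d).
Proof.
move=> r1 s0 ds.
rewrite (_ : (fun y => _) = (fun u : R => `|u| `^ r) \o s); last first.
  by apply/funext => y /=; rewrite ger0_norm.
exact: is_derive_comp1 (is_derive_normr_powR r _ r1 (s0 x)) ds.
Qed.

Lemma is_derive_powR_gt0 (V : normedModType R) (s : V -> R) (x v : V)
    (d r : R) :
  0 < s x -> is_derive x v s d ->
  is_derive x v (fun y => s y `^ r) (r * s x `^ (r - 1) * d).
Proof.
move=> s0 ds; exact: is_derive_comp1 (@is_derive1_powR R r _ s0) ds.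
Qed.

Lemma continuous_powR_ge0 (T : topologicalType) (s : T -> R) (a : R) :
  0 < a -> (forall y, 0 <= s y) -> continuous s ->
  continuous (fun y => s y `^ a).
Proof.
move=> a0 s0 cs.
rewrite (_ : (fun y => _) = (fun u : R => `|u| `^ a) \o s); last first.
  by apply/funext => y /=; rewrite ger0_norm.
by move=> x; apply: continuous_comp; [exact: cs|exact: continuous_normr_powR].
Qed.

Lemma continuous_powR_gt0 (T : topologicalType) (s : T -> R) (a : R) :
  (forall y, 0 < s y) -> continuous s -> continuous (fun y => s y `^ a).
Proof.
move=> s0 cs x; apply: (@continuous_comp T R R s (fun u : R => u `^ a)).
  exact: cs.
apply/differentiable_continuous/derivable1_diffP.
by apply: derivable_powR; rewrite in_itv/= andbT.
Qed.

End power_calculus.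

(** * Lagrange's identity *)

Section lagrange.
Context {R : realType} {m : nat}.
Implicit Types a b : 'I_m -> R.

Lemma lagrange_identity a b :
  \sum_(j < m) \sum_(l < m | (j < l)%N) (b l * a j - b j * a l) ^+ 2 +
    (\sum_(j < m) a j * b j) ^+ 2 = (\sum_(j < m) a j ^+ 2) * (\sum_(j < m) b j ^+ 2).
Proof.
(* Both sides are obtained from the sum of [P j l] over all pairs: by symmetry it
   is twice the sum over [j < l], and it also expands into products of sums. *)
pose P (j l : 'I_m) := (b l * a j - b j * a l) ^+ 2.
have half : \sum_(j < m) \sum_(l < m) P j l =
    (\sum_(j < m) \sum_(l < m | (j < l)%N) P j l) *+ 2.
  rewrite (eq_bigr _ (fun (j : 'I_m) _ =>
    bigID (fun l : 'I_m => (j < l)%N) _ _)) /=.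
  rewrite big_split/= mulr2n; congr (_ + _).
  rewrite (exchange_big_dep xpredT)//=; apply: eq_bigr => l _.
  rewrite [LHS]big_mkcond [RHS]big_mkcond/=; apply: eq_bigr => j _.
  rewrite /P; case: ltngtP => // [_|/val_inj ->].
    by rewrite -sqrrN opprB.
  by rewrite subrr expr0n.
have full : \sum_(j < m) \sum_(l < m) P j l =
    ((\sum_(j < m) a j ^+ 2) * (\sum_(j < m) b j ^+ 2) - (\sum_(j < m) a j * b j) ^+ 2) *+ 2.
  transitivity ((\sum_(j < m) a j ^+ 2) * (\sum_(j < m) b j ^+ 2) +
      (\sum_(j < m) b j ^+ 2) * (\sum_(j < m) a j ^+ 2) -
      ((\sum_(j < m) a j * b j) * (\sum_(j < m) a j * b j)) *+ 2); last by ring.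
  rewrite !big_distrlr/= -sumrMnl -big_split -sumrB/=; apply: eq_bigr => j _.
  rewrite -sumrMnl -big_split -sumrB/=; apply: eq_bigr => l _.
  by rewrite /P; ring.
by move: half; rewrite full; lra.
Qed.

Lemma cauchy_schwarz_sum a b :
  `|\sum_(j < m) a j * b j| <=
    Num.sqrt (\sum_(j < m) a j ^+ 2) * Num.sqrt (\sum_(j < m) b j ^+ 2).
Proof.
rewrite -sqrtrM; last by apply: sumr_ge0 => j _; exact: sqr_ge0.
rewrite -sqrtr_sqr ler_wsqrtr// -lagrange_identity lerDr.
by apply: sumr_ge0 => j _; apply: sumr_ge0 => l _; exact: sqr_ge0.
Qed.

End lagrange.

(** * The Euclidean norm *)

Section sum_of_squares.
Context {R : realType}.

Definition sqnorm {n} (x : 'rV[R]_n) : R := \sum_i x ord0 i ^+ 2.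

Lemma sqnorm_ge0 n (x : 'rV[R]_n) : 0 <= sqnorm x.
Proof. by apply: sumr_ge0 => i _; exact: sqr_ge0. Qed.

Lemma sqr_enorm n (x : 'rV[R]_n) : enorm x ^+ 2 = sqnorm x.
Proof. by rewrite /enorm sqr_sqrtr// sqnorm_ge0. Qed.

Lemma enorm_ge0 n (x : 'rV[R]_n) : 0 <= enorm x.
Proof. exact: sqrtr_ge0. Qed.

Lemma enorm_powR n (x : 'rV[R]_n) (a : R) : enorm x `^ a = sqnorm x `^ (a / 2).
Proof.
by rewrite -sqr_enorm -powR_mulrn ?enorm_ge0// -powRrM mulrC divfK.
Qed.

Lemma continuous_sumr (T : topologicalType) (I : Type) (r : seq I)
    (F : I -> T -> R) :
  (forall i, continuous (F i)) -> continuous (fun x => \sum_(i <- r) F i x).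
Proof.
move=> cF; elim: r => [|i r IHr].
  by under eq_fun do rewrite big_nil; exact: cst_continuous.
under eq_fun do rewrite big_cons.
by move=> x; apply: continuousD; [exact: cF|exact: IHr].
Qed.

Lemma continuous_mulr (T : topologicalType) (F G : T -> R) :
  continuous F -> continuous G -> continuous (fun x => F x * G x).
Proof. by move=> cF cG x; apply: continuousM; [exact: cF|exact: cG]. Qed.

Lemma continuous_addr (T : topologicalType) (F G : T -> R) :
  continuous F -> continuous G -> continuous (fun x => F x + G x).
Proof. by move=> cF cG x; apply: continuousD; [exact: cF|exact: cG]. Qed.

Lemma continuous_oppr (T : topologicalType) (F : T -> R) :
  continuous F -> continuous (fun x => - F x).
Proof. by move=> cF x; apply: continuousN; exact: cF. Qed.

Lemma continuous_sqnorm n : continuous (@sqnorm n).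
Proof.
apply: continuous_sumr => i; apply: continuous_mulr; exact: coord_continuous.
Qed.

Lemma measurable_enorm_powR n k (g : 'rV[R]_n -> 'rV[R]_k) (a : R) :
  continuous (fun x => sqnorm (g x)) ->
  measurable_fun setT (fun x => enorm (g x) `^ a).
Proof.
move=> cg; apply: (@measurableT_comp _ _ _ _ _ _ (@powR R ^~ a)) => //.
apply: continuous_measurable_rV => x.
apply: (@continuous_comp _ _ _ (fun y => sqnorm (g y)) Num.sqrt).
  exact: cg.
exact: sqrt_continuous.
Qed.

Lemma is_derive_sum_sqr (V : normedModType R) k (u : 'I_k -> V -> R)
    (du : 'I_k -> R) (x v : V) :
  (forall j, is_derive x v (u j) (du j)) ->
  is_derive x v (fun y => \sum_j u j y ^+ 2) (2 * \sum_j u j x * du j).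
Proof.
move=> dudu.
rewrite (_ : (fun y => _) = \sum_(j < k) (u j * u j)); last first.
  by apply/funext => y; rewrite fct_sumE.
rewrite mulr_sumr; apply: is_derive_eq; apply: eq_bigr => j _.
by rewrite !/(_ *: _) /=; ring.
Qed.

Lemma is_derive_coord n (x : 'rV[R]_n) (k i : 'I_n) :
  is_derive x (delta_mx ord0 k) (fun y : 'rV[R]_n => y ord0 i) (k == i)%:R.
Proof.
pose g : R -> R := (id * cst (k == i)%:R) + cst (x ord0 i).
have dg : is_derive (0 : R) (1 : R) g (k == i)%:R.
  by apply: is_derive_eq; rewrite !/(_ *: _) /=; ring.
have [dg' <-] := dg; apply: is_derive_eq_line dg' => s.
by rewrite /g/= !mxE !eqxx/= addr0 [s *: 1]mulr1 eq_sym.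
Qed.

Lemma is_derive_sqnorm n (x : 'rV[R]_n) (k : 'I_n) :
  is_derive x (delta_mx ord0 k) sqnorm (2 * x ord0 k).
Proof.
rewrite (_ : x ord0 k = \sum_i x ord0 i * (k == i)%:R).
  by apply: is_derive_sum_sqr => i; exact: is_derive_coord.
rewrite (bigD1 k)//= eqxx mulr1 big1 ?addr0// => i ik.
by rewrite eq_sym (negbTE ik) mulr0.
Qed.

End sum_of_squares.

(** * The regularized vector field *)

Section vector_field.
Context {R : realType} {n m : nat} (f : 'rV[R]_n -> 'rV[R]_m) (p q : R).
Hypothesis f_C1 : forall j : 'I_m, is_Cr 1 (coord_fun f j).
Hypothesis p_gt2 : 2 < p.

(** Half the [k]-th partial derivative of [|f|^2]. *)
Definition dot_partial (k : 'I_n) (x : 'rV[R]_n) : R :=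
  \sum_j coord_fun f j x * partial k (coord_fun f j) x.

(** For [0 < e], a smooth substitute for [|x|^(-q)]. *)
Definition reg_weight (e : R) (x : 'rV[R]_n) : R := (e + sqnorm x) `^ (- (q / 2)).

Definition reg_field (e : R) (k : 'I_n) (x : 'rV[R]_n) : R :=
  sqnorm (f x) `^ (p / 2) * (x ord0 k * reg_weight e x).

(** The [k]-th partial derivative of [reg_field e k], in a form whose continuity
    is plain. *)
Definition reg_field_partial (e : R) (k : 'I_n) (x : 'rV[R]_n) : R :=
  sqnorm (f x) `^ (p / 2) *
    (reg_weight e x - q * x ord0 k ^+ 2 * (e + sqnorm x) `^ (- (q / 2) - 1)) +
  p * sqnorm (f x) `^ (p / 2 - 1) * dot_partial k x * (x ord0 k * reg_weight e x).

Lemma continuous_f j : continuous (coord_fun f j).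
Proof. by case: (f_C1 j). Qed.

Lemma continuous_partial j k : continuous (partial k (coord_fun f j)).
Proof. by have [_ /(_ k)[_]] := f_C1 j. Qed.

Lemma continuous_sqnorm_comp : continuous (fun x => sqnorm (f x)).
Proof.
by apply: continuous_sumr => j; apply: continuous_mulr; exact: continuous_f.
Qed.

Lemma continuous_dot_partial k : continuous (dot_partial k).
Proof.
apply: continuous_sumr => j; apply: continuous_mulr.
  exact: continuous_f.
exact: continuous_partial.
Qed.

Lemma is_derive_sqnorm_comp x k :
  is_derive x (delta_mx ord0 k) (fun y => sqnorm (f y)) (2 * dot_partial k x).
Proof.
apply: (@is_derive_sum_sqr _ _ _ (fun j => coord_fun f j)
  (fun j => partial k (coord_fun f j) x)) => j.
by split => //; have [_ /(_ k)[]] := f_C1 j.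
Qed.

Section regularized.
Variable e : R.
Hypothesis e_gt0 : 0 < e.

Lemma reg_sqnorm_gt0 (x : 'rV[R]_n) : 0 < e + sqnorm x.
Proof. by rewrite ltr_pwDl// sqnorm_ge0. Qed.

Lemma continuous_reg_powR (a : R) :
  continuous (fun x : 'rV[R]_n => (e + sqnorm x) `^ a).
Proof.
apply: continuous_powR_gt0 => [y|x]; first exact: reg_sqnorm_gt0.
by apply: continuousD; [exact: cst_continuous|exact: continuous_sqnorm].
Qed.

Lemma is_derive_reg_field x k :
  is_derive x (delta_mx ord0 k) (reg_field e k) (reg_field_partial e k x).
Proof.
have dr : is_derive x (delta_mx ord0 k) (fun y : 'rV[R]_n => e + sqnorm y)
    (2 * x ord0 k).
  have := is_derive_sqnorm n x k => ds.
  rewrite (_ : (fun y => _) = cst e + sqnorm)//.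
  by apply: is_derive_eq; rewrite add0r.
have p21 : 1 < p / 2 by rewrite ltr_pdivlMr// mul1r.
have dw := is_derive_powR_gt0 _ (fun y : 'rV[R]_n => e + sqnorm y) _ _ _
  (- (q / 2)) (reg_sqnorm_gt0 x) dr.
have dv := is_derive_powR_ge0 _ (fun y => sqnorm (f y)) _ _ _ _ p21
  (fun y => sqnorm_ge0 _ (f y)) (is_derive_sqnorm_comp x k).
have dc := is_derive_coord n x k k.
rewrite (_ : reg_field e k = (fun y => sqnorm (f y) `^ (p / 2)) *
   ((fun y : 'rV[R]_n => y ord0 k) * (fun y => (e + sqnorm y) `^ (- (q / 2)))))//.
apply: is_derive_eq; rewrite eqxx !/(_ *: _) /= /reg_field_partial /reg_weight.
by rewrite !mulrfctE/=; field.
Qed.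

Lemma continuous_reg_field_partial k : continuous (reg_field_partial e k).
Proof.
have cx : continuous (fun x : 'rV[R]_n => x ord0 k) by exact: coord_continuous.
have cw : continuous (reg_weight e) by exact: continuous_reg_powR.
have p2 : 0 < p / 2 by rewrite divr_gt0// (lt_trans _ p_gt2).
have p21 : 0 < p / 2 - 1 by rewrite subr_gt0 ltr_pdivlMr// mul1r.
have s0 x : 0 <= sqnorm (f x) by exact: sqnorm_ge0.
have cs := continuous_sqnorm_comp.
have c1 := continuous_powR_ge0 _ _ _ p2 s0 cs.
have c2 := continuous_powR_ge0 _ _ _ p21 s0 cs.
have c3 := continuous_reg_powR (- (q / 2) - 1).
have cq (a : R) : continuous (fun _ : 'rV[R]_n => a) by exact: cst_continuous.
apply: (continuous_addr _ (fun x => sqnorm (f x) `^ (p / 2) *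
    (reg_weight e x - q * x ord0 k ^+ 2 * (e + sqnorm x) `^ (- (q / 2) - 1)))).
  apply: continuous_mulr c1 _; apply: continuous_addr cw _.
  apply: continuous_oppr; apply: continuous_mulr c3.
  by apply: continuous_mulr (cq q) _; exact: continuous_mulr.
apply: continuous_mulr (continuous_mulr _ _ _ cx cw).
apply: continuous_mulr (continuous_dot_partial k).
exact: continuous_mulr (cq p) c2.
Qed.

End regularized.
End vector_field.

(** * Pointwise estimate of the divergence *)

Section radial_inequality.
Context {R : realType} {n m : nat} (f : 'rV[R]_n -> 'rV[R]_m) (p q : R).

(** [|grad |f||], with the value 0 where [f] vanishes. *)
Definition grad_modulus (x : 'rV[R]_n) : R :=
  Num.sqrt (\sum_k dot_partial f k x ^+ 2) / enorm (f x).

Definition hardy_weight (x : 'rV[R]_n) : R :=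
  enorm (f x) `^ (p - 1) / enorm x `^ (q - 1).

Lemma grad_modulus_ge0 x : 0 <= grad_modulus x.
Proof. by rewrite divr_ge0// ?sqrtr_ge0// enorm_ge0. Qed.

Lemma hardy_weight_ge0 x : 0 <= hardy_weight x.
Proof. by rewrite divr_ge0// powR_ge0. Qed.

Hypothesis f_C1 : forall j : 'I_m, is_Cr 1 (coord_fun f j).
Hypotheses (q_gt0 : 0 < q) (p_gt2 : 2 < p).

Lemma measurable_hardy_weight : measurable_fun setT hardy_weight.
Proof.
apply: measurable_funM.
  by apply: measurable_enorm_powR; exact: continuous_sqnorm_comp.
under eq_fun do rewrite -powRN.
by apply: (measurable_enorm_powR _ _ id); exact: continuous_sqnorm.
Qed.

Lemma measurable_enorm_inv : measurable_fun setT (fun x => (enorm (f x))^-1).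
Proof.
under eq_fun do rewrite -powR_inv1 ?enorm_ge0//.
by apply: measurable_enorm_powR; exact: continuous_sqnorm_comp.
Qed.

Lemma measurable_grad_modulus : measurable_fun setT grad_modulus.
Proof.
apply: measurable_funM measurable_enorm_inv.
apply: continuous_measurable_rV => x.
apply: (@continuous_comp _ _ _ (fun y => \sum_k dot_partial f k y ^+ 2) Num.sqrt).
  apply: continuous_sumr => k.
  by apply: continuous_mulr; exact: continuous_dot_partial.
exact: sqrt_continuous.
Qed.

Lemma reg_weight_le (e : R) (x : 'rV[R]_n) : 0 < e -> 0 < enorm x ->
  reg_weight q e x <= (enorm x `^ q)^-1.
Proof.
move=> e0 x0; rewrite /reg_weight powRN enorm_powR.
have N0 : 0 < sqnorm x by rewrite -sqr_enorm exprn_gt0.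
rewrite lef_pV2 ?posrE ?powR_gt0 ?addr_gt0//.
apply: ge0_ler_powR; rewrite ?nnegrE ?addr_ge0 ?divr_ge0 ?ltW//.
by rewrite ltrDr.
Qed.

(** By Cauchy-Schwarz the sum is at most [|f| |grad |f|| |x|], and
    [|x| / (e + |x|^2)^(q/2) <= |x|^(1-q)] bounds the regularized weight by the
    singular one, uniformly in [e].  Where [f x] or [x] vanishes, so does the
    left-hand side. *)
Lemma radial_derivative_le (e : R) x : 0 < e ->
  sqnorm (f x) `^ (p / 2 - 1) * reg_weight q e x *
    `|\sum_k dot_partial f k x * x ord0 k| <=
  grad_modulus x * hardy_weight x.
Proof.
move=> e0.
set G := Num.sqrt (\sum_k dot_partial f k x ^+ 2).
have G0 : 0 <= G by exact: sqrtr_ge0.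
have CS : `|\sum_k dot_partial f k x * x ord0 k| <= G * enorm x.
  exact: cauchy_schwarz_sum.
have [u0|u0] := eqVneq (enorm (f x)) 0.
  rewrite -sqr_enorm u0 expr0n /= powR0 ?mul0r; last first.
    by rewrite subr_eq0 gt_eqF// ltr_pdivlMr// mul1r.
  by rewrite mulr_ge0 ?grad_modulus_ge0 ?hardy_weight_ge0.
have {}u0 : 0 < enorm (f x) by rewrite lt_neqAle eq_sym u0 enorm_ge0.
have [x0|x0] := eqVneq (enorm x) 0.
  move: CS; rewrite x0 mulr0 normr_le0 => /eqP ->; rewrite normr0 mulr0.
  by rewrite mulr_ge0 ?grad_modulus_ge0 ?hardy_weight_ge0.
have {}x0 : 0 < enorm x by rewrite lt_neqAle eq_sym x0 enorm_ge0.
have -> : sqnorm (f x) `^ (p / 2 - 1) = enorm (f x) `^ (p - 2).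
  by rewrite enorm_powR; congr (_ `^ _); field.
have -> : grad_modulus x * hardy_weight x =
    enorm (f x) `^ (p - 2) * (enorm x `^ q)^-1 * (G * enorm x).
  rewrite /grad_modulus /hardy_weight -/G.
  have -> : enorm (f x) `^ (p - 1) = enorm (f x) `^ (p - 2) * enorm (f x).
    rewrite -[X in _ * X]powRr1 ?enorm_ge0// -powRD.
      by congr (_ `^ _); ring.
    by rewrite (gt_eqF u0) implybT.
  have -> : enorm x `^ q = enorm x `^ (q - 1) * enorm x.
    by rewrite mulrC mulr_powRB1// enorm_ge0.
  have r0 : 0 < enorm x `^ (q - 1) by rewrite powR_gt0.
  by field; rewrite !gt_eqF.
apply: ler_pM => //; first by rewrite mulr_ge0// powR_ge0.
by rewrite ler_wpM2l ?powR_ge0// reg_weight_le.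
Qed.

(** With [N = |x|^2], the radial factor has divergence
    [n (e + N)^(-q/2) - q N (e + N)^(-q/2-1)], which equals
    [(n - q) (e + N)^(-q/2) + q e (e + N)^(-q/2-1)]; the last term is
    nonnegative. *)
Lemma reg_field_divergence_ge (e : R) x : 0 < e ->
  (n%:R - q) * (enorm (f x) `^ p * reg_weight q e x) <=
  \sum_k reg_field_partial f p q e k x + p * (grad_modulus x * hardy_weight x).
Proof.
move=> e0.
set S := enorm (f x) `^ p; set w := reg_weight q e x.
pose W := (e + sqnorm x) `^ (- (q / 2) - 1).
pose Z := sqnorm (f x) `^ (p / 2 - 1).
pose A := \sum_k dot_partial f k x * x ord0 k.
have S0 : 0 <= S by exact: powR_ge0.
have W0 : 0 <= W by exact: powR_ge0.
have eN := reg_sqnorm_gt0 e e0 x.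
have wE : w = (e + sqnorm x) * W.
  rewrite /w /reg_weight /W powRB; last by rewrite (gt_eqF eN) implybT.
  by rewrite powRr1 ?ltW// mulrCA divff ?mulr1// (gt_eqF eN).
have -> : \sum_k reg_field_partial f p q e k x =
    S * (n%:R * w - q * sqnorm x * W) + p * (Z * w * A).
  rewrite /reg_field_partial big_split/=; congr (_ + _).
    rewrite -mulr_sumr -enorm_powR; congr (_ * _).
    rewrite sumrB sumr_const card_ord mulr_natl; congr (_ - _).
    by rewrite /sqnorm mulr_sumr mulr_suml.
  rewrite /A !mulr_sumr; apply: eq_bigr => k _.
  by rewrite -/Z -/w; ring.
have key := radial_derivative_le e x e0.
rewrite -/Z -/w -/A in key.
have Zw0 : 0 <= Z * w by rewrite mulr_ge0// powR_ge0.
have pA : p * (Z * w * A) >= - (p * (grad_modulus x * hardy_weight x)).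
  rewrite -mulrN ler_wpM2l ?(ltW (lt_trans _ p_gt2))// lerNl.
  apply: le_trans key; rewrite -mulrN ler_wpM2l// -normrN ler_norm//.
have E : S * (n%:R * w - q * sqnorm x * W) =
    (n%:R - q) * (S * w) + q * e * (S * W) by rewrite wE; ring.
have SW0 : 0 <= q * e * (S * W) by rewrite !mulr_ge0// ltW.
by rewrite E; move: pA SW0; lra.
Qed.

End radial_inequality.

(** * The weighted inequality of Hardy type *)

Section hardy.
Context {R : realType} {n m : nat} (f : 'rV[R]_n -> 'rV[R]_m) (p q M : R).
Hypothesis f_C1 : forall j : 'I_m, is_Cr 1 (coord_fun f j).
Hypothesis f_supp : forall j : 'I_m, supp_in_box M (coord_fun f j).
Hypotheses (q_gt0 : 0 < q) (p_gt2 : 2 < p) (q_le_n : q <= n%:R).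

Let H (x : 'rV[R]_n) : R := grad_modulus f x * hardy_weight f p q x.

Let p_gt0 : 0 < p. Proof. exact: lt_trans p_gt2. Qed.

Let c_ge0 : 0 <= (n%:R - q) / p.
Proof. by rewrite divr_ge0 ?subr_ge0// ltW. Qed.

Lemma supp_in_box_reg_field e k : supp_in_box M (reg_field f p q e k).
Proof.
move=> x i xi; rewrite /reg_field (_ : sqnorm (f x) = 0).
  by rewrite powR0 ?mul0r// mulf_neq0// ?invr_neq0// gt_eqF.
rewrite /sqnorm big1// => j _.
by rewrite -/(coord_fun f j x) (f_supp j x i xi) expr0n.
Qed.

Lemma integral_reg_divergence e : 0 < e ->
  (lebesgue_rV n).-integrable setT
    (EFin \o (fun x => p^-1 * \sum_k reg_field_partial f p q e k x)) /\
  (\int[lebesgue_rV n]_x (p^-1 * \sum_k reg_field_partial f p q e k x)%:E = 0)%E.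
Proof.
move=> e0.
have E k : partial k (reg_field f p q e k) = reg_field_partial f p q e k.
  by apply/funext => x; have [_ <-] := is_derive_reg_field f p q f_C1 p_gt2 e e0 x k.
have ck := continuous_reg_field_partial f p q f_C1 p_gt2 e e0.
have ik k : (lebesgue_rV n).-integrable setT (EFin \o reg_field_partial f p q e k).
  apply: (continuous_supp_in_box_integrable _ M _ (ck k)).
  by rewrite -E; exact: supp_in_box_partial (supp_in_box_reg_field _ _).
have isum : (lebesgue_rV n).-integrable setT
    (fun x => \sum_k (reg_field_partial f p q e k x)%:E)%E.
  by apply: integrable_sum => // k _; exact: ik.
have sE : (fun x => (p^-1 * \sum_k reg_field_partial f p q e k x)%:E) =
    (fun x => p^-1%:E * \sum_k (reg_field_partial f p q e k x)%:E)%E.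
  by apply/funext => x; rewrite EFinM sumEFin.
split; first by rewrite /comp sE; exact: integrableZl.
rewrite sE integralZl// (@integral_sum _ _ _ _ _ measurableT _ _ ik).
rewrite big1 ?mule0// => k _; rewrite -E.
apply: (integral_partial_eq0 _ _ _ M).
- by move=> x; have [] := is_derive_reg_field f p q f_C1 p_gt2 e e0 x k.
- by rewrite E; exact: ck.
- exact: supp_in_box_reg_field.
Qed.

Lemma measurable_reg_integrand e : 0 < e ->
  measurable_fun setT (fun x => (n%:R - q) / p * (enorm (f x) `^ p * reg_weight q e x)).
Proof.
move=> e0; apply: continuous_measurable_rV.
apply: continuous_mulr; first exact: cst_continuous.
apply: continuous_mulr; last exact: continuous_reg_powR.
under eq_fun do rewrite enorm_powR.
apply: continuous_powR_ge0; first by rewrite divr_gt0.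
  by move=> y; exact: sqnorm_ge0.
exact: continuous_sqnorm_comp.
Qed.

Lemma measurable_radial : measurable_fun setT H.
Proof.
apply: measurable_funM; first exact: measurable_grad_modulus.
exact: measurable_hardy_weight.
Qed.

Let H_ge0 x : 0 <= H x.
Proof. by rewrite mulr_ge0 ?grad_modulus_ge0 ?hardy_weight_ge0. Qed.

(** Integrate the pointwise estimate: the divergence contributes nothing.  Since
    linearity of the integral needs integrability, an infinite right-hand side is
    treated apart. *)
Lemma reg_hardy_inequality e : 0 < e ->
  (\int[lebesgue_rV n]_x ((n%:R - q) / p * (enorm (f x) `^ p * reg_weight q e x))%:E
   <= \int[lebesgue_rV n]_x (H x)%:E)%E.
Proof.
move=> e0.
have [Hoo|Hoo] := eqVneq (\int[lebesgue_rV n]_x (H x)%:E)%E +oo%E.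
  by rewrite Hoo leey.
have iH : (lebesgue_rV n).-integrable setT (EFin \o H).
  apply/integrableP; split.
    by apply/measurable_EFinP; exact: measurable_radial.
  under eq_integral do rewrite gee0_abs ?lee_fin ?H_ge0//.
  by rewrite ltey.
have [iD D0] := integral_reg_divergence e e0.
rewrite -[leRHS]add0e -[X in (X + _)%E]D0 -(integralD measurableT iD iH).
apply: ge0_le_integral => //.
- by move=> x _; rewrite lee_fin mulr_ge0// mulr_ge0// powR_ge0.
- by apply/measurable_EFinP; exact: measurable_reg_integrand.
- apply: emeasurable_funD; first exact: measurable_int iD.
  by apply/measurable_EFinP; exact: measurable_radial.
- move=> x _; rewrite -EFinD lee_fin.
  have := reg_field_divergence_ge f p q q_gt0 p_gt2 e x e0.
  rewrite -/(H x) => h.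
  rewrite [leLHS]mulrAC [leLHS]mulrC -[X in _ <= _ + X](mulKf
    (lt0r_neq0 p_gt0)).
  by rewrite -mulrDr ler_wpM2l// invr_ge0 ltW.
Qed.

Lemma reg_weight_cvg (x : 'rV[R]_n) : 0 < enorm x ->
  (fun i : nat => reg_weight q i.+1%:R^-1 x) @ \oo --> (enorm x `^ q)^-1.
Proof.
move=> x0.
have N0 : 0 < sqnorm x by rewrite -sqr_enorm exprn_gt0.
rewrite enorm_powR -powRN /reg_weight.
apply: (@continuous_cvg _ _ _ _ _ (fun i : nat => i.+1%:R^-1 + sqnorm x)
  (fun u : R => u `^ (- (q / 2)))).
  apply/differentiable_continuous/derivable1_diffP.
  by apply: derivable_powR; rewrite in_itv/= andbT.
rewrite -[X in _ --> X]add0r.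
by apply: cvgD; [exact: cvg_harmonic|exact: cvg_cst].
Qed.

(** Fatou's lemma lets [e] tend to zero, so that no a priori integrability of
    [|f|^p / |x|^q] enters. *)
Lemma hardy_inequality :
  (\int[lebesgue_rV n]_x ((n%:R - q) / p * (enorm (f x) `^ p / enorm x `^ q))%:E
   <= \int[lebesgue_rV n]_x (H x)%:E)%E.
Proof.
pose L (i : nat) (x : 'rV[R]_n) : \bar R :=
  ((n%:R - q) / p * (enorm (f x) `^ p * reg_weight q i.+1%:R^-1 x))%:E.
have i0 (i : nat) : (0 : R) < i.+1%:R^-1 by rewrite invr_gt0.
have mL i : measurable_fun setT (L i).
  by apply/measurable_EFinP; exact: measurable_reg_integrand.
have L0 i x : (0 <= L i x)%E.
  by rewrite lee_fin mulr_ge0// mulr_ge0// powR_ge0.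
apply: (@le_trans _ _ (\int[lebesgue_rV n]_x limn_einf (L ^~ x))%E).
  apply: ge0_le_integral => //.
  - by move=> x _; rewrite lee_fin mulr_ge0// divr_ge0// powR_ge0.
  - apply/measurable_EFinP; apply: measurable_funM => //.
    apply: measurable_funM.
      by apply: measurable_enorm_powR; exact: continuous_sqnorm_comp.
    under eq_fun do rewrite -powRN.
    by apply: (measurable_enorm_powR _ _ id); exact: continuous_sqnorm.
  - rewrite /limn_einf; apply: measurableT_comp => //.
    apply: (measurable_fun_limn_esup (f := fun i x => - L i x)%E) => i.
    exact: measurableT_comp.
  (* At the origin the quotient is [0] by convention, whereas the regularized
     integrands are merely nonnegative. *)
  - move=> x _; have [x0|x0] := eqVneq (enorm x) 0.
      rewrite x0 powR0 ?gt_eqF// invr0 !mulr0 limn_einf_lim.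
      apply: lime_ge; first exact: is_cvg_einfs.
      by apply: nearW => i; apply: le_ereal_inf_tmp => _ [k /= _ <-]; exact: L0.
    have {}x0 : 0 < enorm x by rewrite lt_neqAle eq_sym x0 enorm_ge0.
    have : L ^~ x @ \oo --> ((n%:R - q) / p * (enorm (f x) `^ p / enorm x `^ q))%:E.
      apply: cvg_EFin; first exact: nearW.
      apply: cvgMr; apply: cvgMr; exact: reg_weight_cvg.
    by move=> /cvg_limn_einf_sup[-> _].
apply: le_trans (fatou _ measurableT mL _) _ => //.
rewrite limn_einf_lim; apply: lime_le; first exact: is_cvg_einfs.
apply: nearW => i; apply: le_trans (reg_hardy_inequality _ (i0 i)).
by apply: ereal_inf_lbound; exists i => /=.
Qed.

End hardy.

(** * Cauchy-Schwarz and the splitting of the gradient *)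

Section cauchy_schwarz.
Local Open Scope ereal_scope.
Context d (T : measurableType d) (R : realType).
Variable mu : {measure set T -> \bar R}.

(** Hoelder's inequality for the exponents [2] and [2].  The convention
    [0 * +oo = 0] is the right one here, since a factor of zero makes the product
    vanish almost everywhere. *)
Lemma integral_cauchy_schwarz (a g : T -> R) :
  (forall x, 0 <= a x)%R -> (forall x, 0 <= g x)%R ->
  measurable_fun setT a -> measurable_fun setT g ->
  (\int[mu]_x (a x * g x)%:E) ^+ 2 <=
  \int[mu]_x (a x ^+ 2)%:E * \int[mu]_x (g x ^+ 2)%:E.
Proof.
move=> a0 g0 ma mg.
have N2 (h : T -> R) : (forall x, 0 <= h x)%R ->
    'N[mu]_2%:E[EFin \o h] ^+ 2 = \int[mu]_x (h x ^+ 2)%:E.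
  move=> h0; have N0 : 0 <= 'N[mu]_2%:E[EFin \o h] by exact: Lnorm_ge0.
  transitivity ('N[mu]_2%:E[EFin \o h] `^ 2).
    case: ('N[mu]_2%:E[EFin \o h]) N0 => [r| |] //.
      by rewrite lee_fin => r0; rewrite poweR_EFin powR_mulrn// EFin_expe.
    by rewrite poweRyr// expe2 mulyy.
  rewrite poweR_Lnorm//; apply: eq_integral => x _ /=.
  by rewrite ger0_norm// powR_mulrn.
rewrite -!N2// !expe2 muleACA -!expe2.
have ag0 : 0 <= \int[mu]_x (a x * g x)%:E.
  by apply: integral_ge0 => x _; rewrite lee_fin mulr_ge0.
rewrite lee_sqr ?mule_ge0 ?Lnorm_ge0//.
have half : (2^-1 + 2^-1 = 1 :> R)%R by rewrite [RHS]splitr mul1r.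
have := hoelder mu ma mg (ltr0Sn R 1) (ltr0Sn R 1) half.
rewrite Lnorm1; apply: le_trans; rewrite le_eqVlt; apply/orP; left; apply/eqP.
by apply: eq_integral => x _ /=; rewrite ger0_norm// mulr_ge0.
Qed.

End cauchy_schwarz.

Section gradient_splitting.
Context {R : realType} {n m : nat} (f : 'rV[R]_n -> 'rV[R]_m) (p q : R).
Hypothesis f_C1 : forall j : 'I_m, is_Cr 1 (coord_fun f j).

(** An equality where [f] is nonzero, by Lagrange's identity applied to [f x] and
    [partial k f x] for each [k].  Where [f] vanishes the left-hand side is zero,
    which is the source of the inequality. *)
Lemma grad_sq_ge x :
  grad_modulus f x ^+ 2 + (enorm (f x) * phase_deriv f x) ^+ 2 <= grad_sq f x.
Proof.
have g0 : 0 <= grad_sq f x.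
  by apply: sumr_ge0 => k _; apply: sumr_ge0 => j _; exact: sqr_ge0.
have [u0|u0] := eqVneq (enorm (f x)) 0.
  by rewrite /grad_modulus u0 invr0 mulr0 mul0r expr0n addr0.
have s0 : enorm (f x) ^+ 2 != 0 by rewrite expf_neq0.
have sqr_sum_ge0 (I : finType) (F : I -> R) : 0 <= \sum_i F i ^+ 2.
  by apply: sumr_ge0 => i _; exact: sqr_ge0.
rewrite /grad_modulus /phase_deriv !exprMn exprVn.
rewrite (sqr_sqrtr (sqr_sum_ge0 _ (dot_partial f ^~ x))) 
  [X in _ + _ * X]sqr_sqrtr; last first.
  by do 3![apply: sumr_ge0 => ? _]; exact: sqr_ge0.
rewrite mulr_suml mulr_sumr -big_split /grad_sq /=; apply: ler_sum => k _.
have L := lagrange_identity (fun j => partial k (coord_fun f j) x)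
  (fun j => coord_fun f j x).
set P := \sum_(j < m) \sum_(l < m | _) _ in L.
have -> : \sum_(j < m) \sum_(l < m | (j < l)%N)
    (coord_fun f l x / enorm (f x) ^+ 2 * partial k (coord_fun f j) x -
     coord_fun f j x / enorm (f x) ^+ 2 * partial k (coord_fun f l) x) ^+ 2 =
    P / (enorm (f x) ^+ 2) ^+ 2.
  rewrite /P mulr_suml; apply: eq_bigr => j _.
  rewrite mulr_suml; apply: eq_bigr => l _.
  by field.
under eq_bigr do rewrite real_normK ?num_real//.
have -> : dot_partial f k x = \sum_j partial k (coord_fun f j) x * coord_fun f j x.
  by apply: eq_bigr => j _; rewrite mulrC.
have sE : enorm (f x) ^+ 2 = \sum_j coord_fun f j x ^+ 2 by rewrite sqr_enorm.
rewrite le_eqVlt; apply/orP; left; apply/eqP.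
rewrite -sE in L; apply: (mulIf s0); rewrite -L; field.
by [].
Qed.

Lemma measurable_phase_deriv : measurable_fun setT (phase_deriv f).
Proof.
have mf j : measurable_fun setT (coord_fun f j).
  by apply: continuous_measurable_rV; exact: continuous_f.
have mdf k j : measurable_fun setT (partial k (coord_fun f j)).
  by apply: continuous_measurable_rV; exact: continuous_partial.
have me : measurable_fun setT (fun x => (enorm (f x) ^+ 2)^-1).
  under eq_fun do rewrite -exprVn.
  by apply: measurable_funX; exact: measurable_enorm_inv.
have ms (G : 'rV[R]_n -> R) : measurable_fun setT G ->
    measurable_fun setT (fun x => Num.sqrt (G x)).
  move=> mG; apply: measurableT_comp mG.
  by apply: continuous_measurable_fun; exact: sqrt_continuous.
apply: ms; apply: measurable_sum => k; apply: measurable_sum => j.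
under eq_fun do rewrite big_mkcond.
apply: measurable_sum => l; case: (j < l)%N; last exact: measurable_cst.
apply: measurable_funX; apply: measurable_funB.
  by apply: measurable_funM => //; apply: measurable_funM.
by apply: measurable_funM => //; apply: measurable_funM.
Qed.

Lemma measurable_grad_sq : measurable_fun setT (grad_sq f).
Proof.
apply: measurable_sum => k; apply: measurable_sum => j.
apply: measurable_funX; apply: measurableT_comp => //.
by apply: continuous_measurable_rV; exact: continuous_partial.
Qed.

End gradient_splitting.

(** A compact support is bounded for the norm of the space of row vectors, which
    is the maximum norm, hence it lies in a cube. *)
Lemma C0infty_supp_in_box (R : realType) (n : nat) (g : 'rV[R]_n -> R) :
  C0infty g -> exists M : R, supp_in_box M g.
Proof.
move=> [_ /compact_bounded[M [_ gM]]]; exists (M + 1) => x i xi.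
apply: contraPP (xi) => /eqP gx; apply/negP; rewrite -leNgt.
apply: le_trans (gM (M + 1) _ x _); last 2 first.
- by rewrite ltrDl.
- by apply: subset_closure.
have /mapP[j Hj ->] : `|x ord0 i| \in [seq `|x y.1 y.2| | y : 'I_1 * 'I_n].
  by apply/mapP; exists (ord0, i) => //=; rewrite mem_enum.
by rewrite [leRHS]/Num.Def.normr /= mx_normrE; apply/bigmax_geP; right => /=; exists j.
Qed.

Theorem theorem1p3 (R : realType) (m n : nat) (p q : R)
    (f : 'rV[R]_n -> 'rV[R]_m)
    (m_gt0 : (0 < m)%N)
    (f_test : forall j : 'I_m, C0infty (coord_fun f j))
    (q_gt0 : 0 < q) (q_lt2 : q < 2) (p_gt2 : 2 < p)
    (n_gt2 : (2 < n)%N) (n_lt : n%:R < 2 * (p - q) / (p - 2)) :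
  ((\int[lebesgue_rV n]_x (grad_sq f x)%:E) *
   (\int[lebesgue_rV n]_x
      (enorm (f x) `^ (2 * p - 2) / enorm x `^ (2 * q - 2))%:E)
   >= ((n%:R - q) ^+ 2 / p ^+ 2)%:E *
        (\int[lebesgue_rV n]_x (enorm (f x) `^ p / enorm x `^ q)%:E) ^+ 2
      + COV p q f ^+ 2)%E.
Proof.
have f_C1 j : is_Cr 1 (coord_fun f j) by have [/(_ 1%N)] := f_test j.
have [M f_supp] : exists M : R, forall j, supp_in_box M (coord_fun f j).
  have /choice[M gM] := fun j => C0infty_supp_in_box _ _ _ (f_test j).
  exists (\sum_j `|M j|) => j x i xi; apply: (gM j x i); apply: le_lt_trans xi.
  rewrite (bigD1 j)//= (le_trans (ler_norm _))// lerDl.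
  by apply: sumr_ge0.
have q_le_n : q <= n%:R.
  by rewrite (le_trans (ltW q_lt2))// ler_nat ltnW.
have p_gt0 : 0 < p by exact: lt_trans p_gt2.
have c_ge0 : 0 <= (n%:R - q) / p by rewrite divr_ge0 ?subr_ge0// ltW.
set mu := lebesgue_rV n.
pose a := grad_modulus f; pose b x := enorm (f x) * phase_deriv f x.
pose g := hardy_weight f p q.
have a0 x : 0 <= a x by exact: grad_modulus_ge0.
have b0 x : 0 <= b x by rewrite mulr_ge0 ?enorm_ge0 ?sqrtr_ge0.
have g0 x : 0 <= g x by exact: hardy_weight_ge0.
have ma : measurable_fun setT a by exact: measurable_grad_modulus.
have mg : measurable_fun setT g by exact: measurable_hardy_weight.
have mu_f : measurable_fun setT (fun x => enorm (f x)).
  under eq_fun do rewrite -(powRr1 (enorm_ge0 _ _)).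
  by apply: measurable_enorm_powR; exact: continuous_sqnorm_comp.
have mb : measurable_fun setT b.
  by apply: measurable_funM mu_f _; exact: measurable_phase_deriv.
have gE x : enorm (f x) `^ (2 * p - 2) / enorm x `^ (2 * q - 2) = g x ^+ 2.
  rewrite /g /hardy_weight exprMn exprVn -!powR_mulrn ?powR_ge0// -!powRrM.
  by congr (_ `^ _ / _ `^ _); ring.
have covE : COV p q f = (\int[mu]_x (b x * g x)%:E)%E.
  apply: eq_integral => x _; congr (_%:E).
  rewrite /b /g /hardy_weight -(mulr_powRB1 (enorm_ge0 _ (f x)) p_gt0).
  by ring.
have I0 : (0 <= \int[mu]_x (enorm (f x) `^ p / enorm x `^ q)%:E)%E.
  by apply: integral_ge0 => x _; rewrite lee_fin divr_ge0// powR_ge0.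
have -> : (\int[mu]_x (enorm (f x) `^ (2 * p - 2) / enorm x `^ (2 * q - 2))%:E =
    \int[mu]_x (g x ^+ 2)%:E)%E by apply: eq_integral => x _; rewrite gE.
apply: (@le_trans _ _ (\int[mu]_x (a x ^+ 2)%:E * \int[mu]_x (g x ^+ 2)%:E +
    \int[mu]_x (b x ^+ 2)%:E * \int[mu]_x (g x ^+ 2)%:E)%E).
  apply: leeD; last by rewrite covE; exact: integral_cauchy_schwarz.
  apply: le_trans (integral_cauchy_schwarz _ _ _ _ _ _ a0 g0 ma mg).
  have -> : (((n%:R - q) ^+ 2 / p ^+ 2)%R%:E = ((n%:R - q) / p)%R%:E ^+ 2)%E.
    by rewrite -EFin_expe exprMn exprVn.
  rewrite !expe2 muleACA -!expe2 lee_sqr ?mule_ge0//; last first.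
    by apply: integral_ge0 => x _; rewrite lee_fin mulr_ge0.
  rewrite -ge0_integralZl_EFin//.
  - exact: hardy_inequality f_C1 f_supp q_gt0 p_gt2 q_le_n.
  - by move=> x _; rewrite lee_fin divr_ge0// powR_ge0.
  - apply/measurable_EFinP; apply: measurable_funM.
      by apply: measurable_enorm_powR; exact: continuous_sqnorm_comp.
    under eq_fun do rewrite -powRN.
    by apply: (measurable_enorm_powR _ _ id); exact: continuous_sqnorm.
have sq0 (h : 'rV[R]_n -> R) : (0 <= \int[mu]_x (h x ^+ 2)%:E)%E.
  by apply: integral_ge0 => x _; rewrite lee_fin sqr_ge0.
have msq (h : 'rV[R]_n -> R) : measurable_fun setT h ->
    measurable_fun setT (fun x => (h x ^+ 2)%:E).
  by move=> mh; apply/measurable_EFinP; exact: measurable_funX.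
have sqE (h : 'rV[R]_n -> R) x : setT x -> (0 <= (h x ^+ 2)%:E)%E.
  by move=> _; rewrite lee_fin sqr_ge0.
rewrite -ge0_muleDl// -ge0_integralD//;
  [|exact: sqE|exact: msq|exact: sqE|exact: msq].
apply: lee_wpmul2r => //; apply: ge0_le_integral => //.
- by move=> x _; rewrite adde_ge0// lee_fin sqr_ge0.
- by apply: emeasurable_funD; exact: msq.
- by apply/measurable_EFinP; exact: measurable_grad_sq.
- by move=> x _; rewrite -EFinD lee_fin; exact: grad_sq_ge.
Qed.
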